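(* Let $G$ be a finite simple graph of order $n$. Then either $G$ has infinite leaf rank, or the leaf rank of $G$ is at most $2n\cdot 2^{2n}$.
   Context: For a graph $G$ and an integer $k$, a tree $T$ is a $k$-leaf root of $G$ if the set of leaves of $T$ equals $V(G)$ and any two distinct vertices $u,v$ of $G$ are adjacent in $G$ if and only if their distance in $T$ is at most $k$. The leaf rank of $G$ is the smallest $k$ such that $G$ has a $k$-leaf root, if some such $k$ exists; otherwise $G$ has infinite leaf rank. *)

(* Defs.v *)
From mathcomp Require Import all_boot.

Set Implicit Arguments.
Unset Strict Implicit.
Unset Printing Implicit Defensive.

Record sgraph := SGraph {
  vertex :> finType;
  adj : rel vertex;
  adj_sym : symmetric adj;
  adj_irr : irreflexive adj
}.

Section Graph.
Variable G : sgraph.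

Definition degree (x : G) : nat := #|[set y | adj x y]|.

Definition leaves : {set G} := [set x | degree x == 1].

Definition walk (d : nat) (x y : G) : bool :=
  [exists p : d.-tuple G, path (@adj G) x p && (last x p == y)].

(* The least d such that walk d x y: a shortest walk has fewer than #|G| edges,
   and the value #|G| is returned only when x and y are not connected. *)
Definition dist (x y : G) : nat :=
  find (fun d => walk d x y) (iota 0 #|G|).

Definition connected : Prop := forall x y : G, connect (@adj G) x y.

(* The sequence [:: x; y] is a cycle for the relation adj as soon as x and y
   are adjacent, hence the bound 2. *)
Definition acyclic : Prop :=
  forall c : seq G, cycle (@adj G) c -> uniq c -> size c <= 2.

Definition is_tree : Prop := [/\ 0 < #|G|, connected & acyclic].

End Graph.

(* V(G) is identified with the set of leaves of T through the injection f. *)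
Definition leaf_root (k : nat) (G T : sgraph) : Prop :=
  is_tree T /\
  exists f : G -> T,
    [/\ injective f,
        leaves T = [set f v | v : G]
      & forall u v : G, u != v -> adj u v = (dist (f u) (f v) <= k)].

Definition has_leaf_root (k : nat) (G : sgraph) : Prop :=
  exists T : sgraph, leaf_root k G T.

Definition is_leaf_rank (G : sgraph) (k : nat) : Prop :=
  has_leaf_root k G /\ forall j : nat, has_leaf_root j G -> k <= j.

Definition infinite_leaf_rank (G : sgraph) : Prop :=
  ~ exists k : nat, has_leaf_root k G.

(* Main.v *)
(* Root a k-leaf root T at one of its leaves z and let M u v be the depth of the
   meet of the leaves u and v, so that d(u, v) = l u + l v - 2 M u v.  M is an
   ultrametric similarity, hence takes at most n - 1 values off the diagonal.
   Adjacency only says whether a u + a v <= H (M u v) or >= H (M u v) + 1, where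
   a u = l u - k / 2 and H = 2 M is nondecreasing with H 0 = 0.  This is a linear
   system in the n numbers a u and the at most n - 1 values of H, whose rows have
   squared norm at most 3 and whose right-hand sides are 0 or 1.  By Cramer's
   rule and Hadamard's inequality it has an integer solution with entries at
   most B = 2^(2n-1).  Composing M with the new H keeps it ultrametric, so the
   new values are those of a tree; adding a large constant to all leaf depths
   makes them exceed the depths of the meets, at the price k = 6 B + 2. *)
Require Import Defs.
From mathcomp Require Import all_boot all_order all_algebra.
From mathcomp Require Import zify ring.
From Stdlib Require Import Classical.

Set Implicit Arguments.
Unset Strict Implicit.
Unset Printing Implicit Defensive.

(** * Small integer solutions of linear inequalities *)

Section LinearAlgebra.
Import Order.TTheory GRing.Theory Num.Theory.
Local Open Scope ring_scope.

(** * Gram determinants and Hadamard's inequality *)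

Lemma row_gramE (F : comNzRingType) n (v : 'rV[F]_n) : (v *m v^T) 0 0 = \sum_j v 0 j ^+ 2.
Proof. by rewrite mxE; apply: eq_bigr => j _; rewrite mxE expr2. Qed.

Lemma row_gram_ge0 (F : realFieldType) n (v : 'rV[F]_n) : 0 <= (v *m v^T) 0 0.
Proof. by rewrite row_gramE sumr_ge0 // => j _; apply: sqr_ge0. Qed.

Lemma row_gram_eq0 (F : realFieldType) n (v : 'rV[F]_n) : v *m v^T = 0 -> v = 0.
Proof.
move/matrixP/(_ 0 0); rewrite row_gramE mxE => /eqP.
rewrite psumr_eq0 => [/allP v0|j _]; last exact: sqr_ge0.
apply/rowP => j; rewrite mxE; apply/eqP; rewrite -sqrf_eq0.
by apply: v0; rewrite mem_index_enum.
Qed.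

(** A Gram determinant is a squared volume: adding a row multiplies it by the squared length of the
    component orthogonal to the other rows, which is at most that of the row. The lower bound 0 is
    carried along so that the inequalities can be multiplied. *)
Lemma gram_det_bound (F : realFieldType) m n (V : 'M[F]_(m, n)) :
  0 <= \det (V *m V^T) <= \prod_i \sum_j V i j ^+ 2.
Proof.
elim: m V => [|m IH] V; first by rewrite det_mx00 big_ord0 ler01 lexx.
pose v : 'rV_n := usubmx (V : 'M_(1 + m, n)).
pose W : 'M_(m, n) := dsubmx (V : 'M_(1 + m, n)).
have defV : V = col_mx v W by rewrite vsubmxK.
have -> : \prod_i \sum_j V i j ^+ 2
    = (v *m v^T) 0 0 * \prod_i \sum_j W i j ^+ 2.
  rewrite big_ord_recl row_gramE; congr (_ * _).
    by apply: eq_bigr => j _; rewrite mxE; congr (V _ _ ^+ 2); apply: val_inj.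
  apply: eq_bigr => i _; apply: eq_bigr => j _; rewrite mxE.
  by congr (V _ _ ^+ 2); apply: val_inj.
have /andP[C0 Cle] := IH W.
suff [q /andP[q0 q_le] ->] : exists2 q, 0 <= q <= (v *m v^T) 0 0
    & \det (V *m V^T) = q * \det (W *m W^T).
  by rewrite mulr_ge0 // ler_pM.
have [det0|det_neq0] := eqVneq (\det (W *m W^T)) 0.
  (* If [u] kills [W *m W^T], then [u *m W] has squared norm 0; so [u], padded with a zero, kills
     the Gram matrix of [V]. *)
  exists 0; rewrite ?lexx ?row_gram_ge0 // mul0r; apply/eqP/det0P.
  have /det0P[u u0 uC] : \det (W *m W^T) == 0 by apply/eqP.
  have uW : u *m W = 0.
    by apply: row_gram_eq0; rewrite trmx_mul mulmxA -(mulmxA u) uC mul0mx.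
  exists (row_mx (0 : 'rV_1) u).
    apply: contraNneq u0 => /(congr1 (@rsubmx F 1 1 m)).
    by rewrite row_mxKr => ->; rewrite linear0.
  have rV : row_mx (0 : 'rV_1) u *m (V : 'M_(1 + m, n)) = 0.
    by rewrite defV mul_row_col mul0mx add0r.
  by apply: etrans (mulmxA _ _ _) _; rewrite rV mul0mx.
(* The first row may be replaced by its component w orthogonal to the others. *)
have unitC : W *m W^T \in unitmx by rewrite unitmxE unitfE.
pose c := v *m W^T *m invmx (W *m W^T); pose w := v - c *m W.
have wW : w *m W^T = 0 by rewrite mulmxBl -mulmxA mulmxKV // subrr.
have Ww : W *m w^T = 0 by rewrite -[LHS]trmxK trmx_mul trmxK wW trmx0.
exists ((w *m w^T) 0 0).
  have -> : v *m v^T = w *m w^T + c *m W *m (c *m W)^T.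
    have cross : w *m (c *m W)^T = 0 by rewrite trmx_mul mulmxA wW mul0mx.
    have cross' : c *m W *m w^T = 0 by rewrite -mulmxA Ww mulmx0.
    rewrite -[v](subrK (c *m W)) -/w [(_ + _)^T]linearD /=.
    by rewrite mulmxDl !mulmxDr cross cross' addr0 add0r.
  by rewrite row_gram_ge0 [X in _ <= X]mxE lerDl row_gram_ge0.
(* Unipotent row operation: the determinant is unchanged and the Gram matrix becomes block
   diagonal. *)
pose U : 'M[F]_(1 + m) := block_mx 1%:M (- c) 0 1%:M.
have UV : U *m V = col_mx w W.
  by rewrite defV mul_block_col !mul1mx mul0mx add0r mulNmx.
have detU : \det U = 1 by rewrite det_ublock !det1 mulr1.
transitivity (\det (U *m V *m (U *m V)^T)).
  by rewrite trmx_mul mulmxA -(mulmxA U) !det_mulmx det_tr detU mul1r mulr1.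
rewrite UV tr_col_mx mul_col_row wW Ww det_ublock det_mx11 //.
Qed.

Lemma hadamard_bound (F : realFieldType) n (A : 'M[F]_n) :
  \det A ^+ 2 <= \prod_i \sum_j A i j ^+ 2.
Proof.
by have /andP[_] := gram_det_bound A; rewrite det_mulmx det_tr expr2.
Qed.

(** The 4 leaves room for squared norm 3 from the coefficients and 1 from the right-hand side that
    Cramer's rule inserts. *)
Lemma int_det_bound n (A : 'M[int]_n) :
  (forall i, \sum_j A i j ^+ 2 <= 4) -> `|\det A| <= 2 ^+ n.
Proof.
move=> rowA; rewrite -ler_sqr ?nnegrE // ?exprn_ge0 // real_normK ?num_real //.
rewrite -exprM mulnC exprM -(ler_int rat) rmorphXn /= -det_map_mx.
apply: le_trans (hadamard_bound _) _.
have -> : ((2 ^+ 2) ^+ n)%:~R = \prod_(i < n) 4 :> rat.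
  by rewrite prodr_const card_ord rmorphXn.
apply: ler_prod => i _; rewrite sumr_ge0 /= => [|j _]; last exact: sqr_ge0.
have := rowA i; rewrite -(ler_int rat) rmorph_sum /=; apply: le_trans.
by apply: ler_sum => j _; rewrite mxE rmorphXn.
Qed.

Lemma map_intr_mx_inj m n :
  injective (map_mx intr : 'M[int]_(m, n) -> 'M[rat]_(m, n)).
Proof.
move=> A B /matrixP eqAB; apply/matrixP => i j; apply: (@intr_inj rat).
by have := eqAB i j; rewrite ![map_mx _ _ _ _]mxE.
Qed.

(** The entries of [y] are Cramer numerators, up to a common sign; keeping the denominator [D] on
    the right makes them integers. *)
Lemma small_solution_equations m N (M : 'M[int]_(m, N)) (c : 'cV[int]_m) (x : 'cV[rat]_N) :
  (forall i, \sum_j M i j ^+ 2 <= 3) -> (forall i, 0 <= c i 0 <= 1) ->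
  map_mx intr M *m x = map_mx intr c ->
  exists D (y : 'cV[int]_N),
    [/\ 0 < D, M *m y = D *: c & forall j, `|y j 0| <= 2 ^+ N].
Proof.
move=> rowM c01 Mx; pose Mq : 'M[rat]_(m, N) := map_mx intr M.
(* Solve a maximal nonsingular square subsystem, with the other unknowns 0. *)
pose f := maxrankfun Mq; pose R := rowsub f Mq.
have fullR : row_full R^T.
  by rewrite /row_full mxrank_tr; apply: maxrowsub_free.
pose g := fullrankfun fullR.
have g_inj : injective g by apply: fullrankfun_inj.
pose S := mxsub f g M.
have det_S : \det S != 0.
  have := fullrowsub_unit fullR; rewrite unitmxE -det_tr unitfE.
  rewrite -(intr_eq0 rat) -det_map_mx.
  congr (\det _ != 0); apply/matrixP => i j; by rewrite !mxE.
pose y0 := \adj S *m rowsub f c.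
have Sy0 : S *m y0 = \det S *: rowsub f c.
  by rewrite mulmxA mul_mx_adj mul_scalar_mx.
have y0_le k : `|y0 k 0| <= 2 ^+ \rank Mq.
  (* Cramer's rule: column [k] of [S] is replaced by the right-hand side, so rows have squared norm
     at most 3 + 1. *)
  pose S' := \matrix_(i, l) (if l == k then c (f i) 0 else S i l).
  have -> : y0 k 0 = \det S'.
    rewrite (expand_det_col _ k) mxE; apply: eq_bigr => i _.
    rewrite !mxE eqxx mulrC; congr (_ * (_ * \det _)).
    apply/matrixP => a b; rewrite !mxE.
    by rewrite eq_sym (negPf (neq_lift _ _)).
  apply: int_det_bound => i; rewrite (bigD1 k) //= mxE eqxx.
  have c1 : c (f i) 0 ^+ 2 <= 1 by have := c01 (f i); nia.
  suff : \sum_(l | l != k) S' i l ^+ 2 <= 3 by apply: lerD c1.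
  apply: le_trans (rowM (f i)).
  rewrite (eq_bigr (fun l => M (f i) (g l) ^+ 2)) => [|l /negPf lk]; last first.
    by rewrite !mxE lk.
  rewrite -(big_imset (fun j => M (f i) j ^+ 2)) /= => [|? ? _ _ /g_inj //].
  rewrite [leRHS](bigID [in [set g l | l in [pred l | l != k]]]) /= lerDl.
  by apply: sumr_ge0 => j _; apply: sqr_ge0.
(* [P] puts the chosen unknowns back in their places, with 0 elsewhere. *)
pose P : 'M[int]_(N, \rank Mq) := \matrix_(j, k) (j == g k)%:R.
have MP : M *m P = colsub g M.
  apply/matrixP => i k; rewrite !mxE (bigD1 (g k)) //= mxE eqxx mulr1 big1 ?addr0 //.
  by move=> j /negPf jk; rewrite mxE jk mulr0.
have Py0_le j : `|(P *m y0) j 0| <= 2 ^+ N.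
  rewrite mxE; case: (pickP (fun k => j == g k)) => [k /eqP jk|no_k]; last first.
    by rewrite big1 ?normr0 ?exprn_ge0 // => k _; rewrite mxE no_k mul0r.
  rewrite (bigD1 k) //= mxE jk eqxx mul1r big1 ?addr0 => [|l neq_l].
    by apply: le_trans (y0_le k) _; rewrite ler_eXn2l // rank_leq_col.
  by rewrite mxE (inj_eq g_inj) eq_sym (negPf neq_l) mul0r.
(* The other equations come for free: since [x] solves the system, [c] depends on its selected
   entries through the same [E] as the rows of [Mq]. *)
have [E defE] : exists E, Mq = E *m R by apply/submxP; rewrite eq_maxrowsub.
have def_c : map_mx intr c = E *m map_mx intr (rowsub f c).
  rewrite -Mx -/Mq {1}defE -mulmxA; congr (_ *m _).
  by rewrite mul_rowsub_mx Mx; apply/matrixP => i j; rewrite !mxE.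
have RPy0 : rowsub f M *m (P *m y0) = \det S *: rowsub f c.
  rewrite mulmxA mul_rowsub_mx MP -Sy0; congr (_ *m _).
  by apply/matrixP => i j; rewrite !mxE.
have mapR : R = map_mx intr (rowsub f M).
  by apply/matrixP => i j; rewrite !mxE.
have MPy0 : M *m (P *m y0) = \det S *: c.
  apply: map_intr_mx_inj.
  rewrite map_mxM -/Mq {1}defE -mulmxA mapR -map_mxM RPy0.
  by rewrite !map_mxZ -scalemxAr -def_c.
exists `|\det S|, (Num.sg (\det S) *: (P *m y0)); split.
- by rewrite normr_gt0.
- by rewrite -scalemxAr MPy0 scalerA -normrEsg.
by move=> j; rewrite mxE normrM normr_sg det_S mul1r.
Qed.

(* The tight inequalities at z determine the values A *m z: z plays the part of a
   vertex, even when the polyhedron has none. *)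
Lemma vertex_exists m N (A : 'M[rat]_(m, N)) (b : 'cV[rat]_m) (x : 'cV[rat]_N) :
  (forall i, b i 0 <= (A *m x) i 0) ->
  exists (T : {set 'I_m}) (z : 'cV[rat]_N),
    [/\ forall i, b i 0 <= (A *m z) i 0,
        forall i, i \in T -> (A *m z) i 0 = b i 0
      & (A <= \matrix_(i, j) (if i \in T then A i j else 0))%MS].
Proof.
pose tight (z : 'cV[rat]_N) := [set i | (A *m z) i 0 == b i 0].
pose mask (T : {set 'I_m}) := \matrix_(i, j) (if i \in T then A i j else 0).
(* Induction on the number of inequalities that are not tight. *)
have [k] := ubnP (m - #|tight x|); elim: k x => // k IH x le_k feas.
have [sub|/negP] := boolP (A <= mask (tight x))%MS.
  by exists (tight x), x; split=> // i; rewrite inE => /eqP.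
rewrite submxE => nz.
(* If the tight rows do not span [A], some direction [d] is orthogonal to them but not to all rows;
   its sign is chosen so that some row decreases. *)
have [d maskd [i0 Ad0]] : exists2 d : 'cV[rat]_N, mask (tight x) *m d = 0
    & exists i, (A *m d) i 0 < 0.
  have /matrix0Pn[i [j]] : A *m cokermx (mask (tight x)) != 0 by apply/negP.
  pose d := col j (cokermx (mask (tight x))).
  have -> : (A *m cokermx (mask (tight x))) i j = (A *m d) i 0.
    by rewrite [LHS]mxE [RHS]mxE; apply: eq_bigr => k0 _; rewrite [d _ _]mxE.
  have mask_d : mask (tight x) *m d = 0.
    by rewrite /d colE (mulmxA (mask _)) mulmx_coker mul0mx.
  rewrite neq_lt => /orP[neg|pos]; first by exists d => //; exists i.
  exists (- d); first by rewrite mulmxN mask_d oppr0.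
  by exists i; rewrite mulmxN mxE oppr_lt0.
have tightd i : i \in tight x -> (A *m d) i 0 = 0.
  move=> ti; have /matrixP/(_ i 0) := maskd; rewrite !mxE => mask0.
  by rewrite -[RHS]mask0; apply: eq_bigr => j _; rewrite mxE ti.
pose s i := (A *m x) i 0 - b i 0; pose e i := - (A *m d) i 0.
(* Ratio test: along [d], row [i1] is among the first to become tight. *)
have [i1 e1 min1] : exists2 i, 0 < e i & forall j, 0 < e j -> s i / e i <= s j / e j.
  have e0 : 0 < e i0 by rewrite oppr_gt0.
  case: (@arg_minP _ _ _ i0 (fun i => 0 < e i) (fun i => s i / e i) e0) => i ei mini.
  by exists i.
pose t := s i1 / e i1; pose x' := x + t *: d.
have t0 : 0 <= t by apply: divr_ge0; [rewrite subr_ge0 | apply: ltW].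
have Ax' i : (A *m x') i 0 - b i 0 = s i - t * e i.
  by rewrite mulmxDr -scalemxAr [addmx _ _ _ _]mxE [scalemx _ _ _ _]mxE /s /e mulrN opprK addrAC.
apply: (IH x') => [|i].
  suff: tight x \proper tight x'.
    by move/proper_card; have := max_card (tight x'); rewrite card_ord; lia.
  apply/properP; split.
    apply/subsetP => i ti; rewrite inE -subr_eq0 Ax' /e tightd // oppr0 mulr0.
    by move: ti; rewrite inE subr0 subr_eq0.
  exists i1; first by rewrite inE -subr_eq0 Ax' /t divfK ?subrr // gt_eqF.
  by apply: contraTN e1 => /tightd; rewrite /e => ->; rewrite oppr0 ltxx.
rewrite -subr_ge0 Ax' subr_ge0.
have [ei|ei] := ltP 0 (e i); first by rewrite -ler_pdivlMr // min1.
by apply: (@le_trans _ _ 0); rewrite ?mulr_ge0_le0 // subr_ge0.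
Qed.

(** An integral [y] solving the tight equations scaled by [D] agrees with [D] times the vertex [z]
    on the tight rows and hence, as these span [A], on all rows. *)
Lemma small_solution_mx m N (A : 'M[int]_(m, N)) (b : 'cV[int]_m) (x : 'cV[rat]_N) :
  (forall i, \sum_j A i j ^+ 2 <= 3) -> (forall i, 0 <= b i 0 <= 1) ->
  (forall i, (b i 0)%:~R <= (map_mx intr A *m x) i 0) ->
  exists y : 'cV[int]_N,
    (forall i, b i 0 <= (A *m y) i 0) /\ forall j, `|y j 0| <= 2 ^+ N.
Proof.
move=> rowA b01 feas; pose Aq : 'M[rat]_(m, N) := map_mx intr A.
have [|T [z [feas_z tight_z sub]]] := @vertex_exists _ _ Aq (map_mx intr b) x.
  by move=> i; rewrite [leLHS]mxE.
pose M := \matrix_(i, j) (if i \in T then A i j else 0).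
pose c := \col_i (if i \in T then b i 0 else 0).
have defM : map_mx intr M = \matrix_(i, j) (if i \in T then Aq i j else 0).
  by apply/matrixP => i j; rewrite !mxE; case: ifP.
have Mz : map_mx intr M *m z = map_mx intr c.
  apply/colP => i; rewrite defM !mxE; case: ifP => Ti.
    have := tight_z i Ti; rewrite !mxE => <-.
    by apply: eq_bigr => j _; rewrite !mxE Ti.
  by rewrite big1 // => j _; rewrite mxE Ti mul0r.
have [||D [y [D0 My y_le]]] := small_solution_equations _ _ Mz.
- move=> i; case: (boolP (i \in T)) => Ti.
    by rewrite (eq_bigr (fun j => A i j ^+ 2)) // => j _; rewrite mxE Ti.
  by rewrite big1 // => j _; rewrite mxE (negPf Ti) expr0n.
- by move=> i; rewrite mxE; case: ifP.
exists y; split=> // i.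
have {sub}[E defE] : exists E, Aq = E *m map_mx intr M.
  by apply/submxP; rewrite defM.
have Ay : map_mx intr (A *m y) = D%:~R *: (Aq *m z) :> 'cV[rat]_m.
  rewrite map_mxM -/Aq defE -!mulmxA Mz -map_mxM My map_mxZ.
  by rewrite -scalemxAr.
have := feas_z i; rewrite -(ler_pM2l (_ : 0 < D%:~R)) ?ltr0z //.
have /colP/(_ i) := Ay; rewrite [RHS]mxE => <-.
rewrite ![map_mx _ _ _ _]mxE -intrM ler_int.
(* The denominator D is cleared for free because b is nonnegative. *)
apply: le_trans; apply: ler_peMl; first by case/andP: (b01 i).
by rewrite -gtz0_ge1.
Qed.

Lemma sum_enum_val (J : finType) (F : J -> int) :
  \sum_j F j = \sum_(k < #|J|) F (enum_val k).
Proof. by rewrite -(big_enum_val (A := J)); apply: eq_bigl. Qed.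

Lemma small_solution (I J : finType) (A : I -> J -> int) (b : I -> int)
    (x : J -> int) :
  (forall i, \sum_j A i j ^+ 2 <= 3) -> (forall i, 0 <= b i <= 1) ->
  (forall i, b i <= \sum_j A i j * x j) ->
  exists y : J -> int,
    (forall i, b i <= \sum_j A i j * y j) /\ forall j, `|y j| <= 2 ^+ #|J|.
Proof.
move=> rowA b01 feas.
pose M := \matrix_(i < #|I|, j < #|J|) A (enum_val i) (enum_val j).
pose c := \col_(i < #|I|) b (enum_val i).
pose x' : 'cV[rat]_#|J| := \col_j (x (enum_val j))%:~R.
have [i|i|i|y [feas_y y_le]] := @small_solution_mx _ _ M c x'.
- rewrite (eq_bigr (fun j => A (enum_val i) (enum_val j) ^+ 2)).
    by rewrite -(sum_enum_val (fun j => A (enum_val i) j ^+ 2)).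
  by move=> j _; rewrite mxE.
- by rewrite mxE.
- rewrite !mxE; have := feas (enum_val i).
  rewrite sum_enum_val -(ler_int rat) rmorph_sum => /le_trans; apply.
  by apply: ler_sum => j _; rewrite !mxE rmorphM.
exists (fun j => y (enum_rank j) 0); split=> // i.
have := feas_y (enum_rank i); rewrite !mxE enum_rankK => /le_trans; apply.
by rewrite [leRHS]sum_enum_val; apply: ler_sum => j _; rewrite !mxE enum_valK enum_rankK.
Qed.

(* None stands for an unknown that is forced to be 0. *)
Definition slot_value m (c : 'I_m -> int) (o : option 'I_m) : int :=
  if o is Some i then c i else 0.

Lemma slot_sum m (c : 'I_m -> int) o :
  \sum_i (o == Some i)%:R * c i = slot_value c o.
Proof.
case: o => [k|] /=; last by rewrite big1 // => i _; rewrite mul0r.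
rewrite (bigD1 k) //= eqxx mul1r big1 ?addr0 // => i ik.
by rewrite (inj_eq Some_inj) eq_sym (negPf ik) mul0r.
Qed.

Lemma slot_sum1 m (o : option 'I_m) : \sum_i (o == Some i)%:R <= 1 :> int.
Proof.
rewrite (eq_bigr (fun i => (o == Some i)%:R * 1)) => [|i _]; last by rewrite mulr1.
by rewrite (slot_sum (fun=> 1)); case: o.
Qed.

Lemma pair_sum (V : finType) (a : V -> int) u v :
  \sum_w ((w == u)%:R + (w == v)%:R) * a w = a u + a v.
Proof.
have delta t : \sum_w (w == t)%:R * a w = a t.
  by rewrite (bigD1 t) //= eqxx mul1r big1 ?addr0 // => w /negPf->; rewrite mul0r.
by rewrite -!delta -big_split; apply: eq_bigr => w _; rewrite mulrDl.
Qed.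

(** A pair condition involves two vertex weights and at most one slot, an order condition at most
    two slots, all with coefficients 1 or -1; this is where the row bound 3 comes from. *)
Lemma small_weights (V : finType) (E : rel V) m (h : V -> V -> option 'I_m)
    (le_h : rel (V * V)) (a0 : V -> int) (c0 : 'I_m -> int) :
  let weights (a : V -> int) (c : 'I_m -> int) :=
    (forall u v, u != v ->
       if E u v then a u + a v <= slot_value c (h u v)
       else slot_value c (h u v) + 1 <= a u + a v)
    /\ (forall p q, le_h p q ->
          slot_value c (h p.1 p.2) <= slot_value c (h q.1 q.2)) in
  weights a0 c0 ->
  exists a c, [/\ weights a c, forall u, `|a u| <= 2 ^+ (#|V| + m)
    & forall i, `|c i| <= 2 ^+ (#|V| + m)].
Proof.
move=> weights [pair0 le0].
(* One row for each pair and one for each pair of pairs; indices that carry no condition get a zero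
   row with right-hand side 0. *)
pose I : finType := ((V * V) + ((V * V) * (V * V)))%type.
pose J : finType := (V + 'I_m)%type.
pose A (i : I) (j : J) : int :=
  match i, j with
  | inl (u, v), inl w =>
      if u == v then 0 else (-1) ^+ E u v * ((w == u)%:R + (w == v)%:R)
  | inl (u, v), inr k =>
      if u == v then 0 else - (-1) ^+ E u v * (h u v == Some k)%:R
  | inr (p, q), inl w => 0
  | inr (p, q), inr k => if le_h p q then
      (h q.1 q.2 == Some k)%:R - (h p.1 p.2 == Some k)%:R else 0
  end.
pose b (i : I) : int := if i is inl (u, v) then (~~ ((u == v) || E u v))%:R else 0.
have sumJ (F : J -> int) : \sum_j F j = \sum_w F (inl w) + \sum_k F (inr k).
  exact: big_sumType.
have AE (y : J -> int) (i : I) : \sum_j A i j * y j =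
  match i with
  | inl (u, v) => if u == v then 0 else
      (-1) ^+ E u v * (y (inl u) + y (inl v) - slot_value (y \o inr) (h u v))
  | inr (p, q) => if le_h p q then slot_value (y \o inr) (h q.1 q.2)
      - slot_value (y \o inr) (h p.1 p.2) else 0
  end.
  rewrite sumJ; case: i => [[u v]|[p q]] /=.
    case: eqP => _; first by rewrite !big1 // => *; rewrite mul0r.
    rewrite mulrDr -(pair_sum (y \o inl)) -(slot_sum (y \o inr)) !mulr_sumr.
    congr (_ + _); first by apply: eq_bigr => w _; rewrite mulrA.
    by rewrite -sumrN mulr_sumr; apply: eq_bigr => k _ /=; ring.
  rewrite big1 ?add0r => [|w _]; last by rewrite mul0r.
  case: ifP => _; last by rewrite big1 // => *; rewrite mul0r.
  rewrite -!(slot_sum (y \o inr)) -sumrB.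
  by apply: eq_bigr => k _ /=; rewrite mulrBl.
have boolXX (x : bool) : (x%:R ^+ 2 : int) = x%:R by case: x.
have [i|i|[[u v]|[p q]]|y [feas y_le]] := @small_solution I J A b
    (fun j => match j with inl w => a0 w | inr k => c0 k end).
- rewrite sumJ; case: i => [[u v]|[p q]] /=.
    case: eqVneq => [_|uv]; first by rewrite !big1 // => *; rewrite expr0n.
    apply: (@le_trans _ _ (2 + 1)) => //; apply: lerD.
      rewrite -[2]/((fun=> 1) u + (fun=> 1) v) -pair_sum.
      apply: ler_sum => w _; rewrite exprMn sqrr_sign mul1r mulr1.
      by case: (eqVneq w u) => [->|_]; rewrite ?(negPf uv); case: (w == v).
    apply: le_trans (slot_sum1 (h u v)); apply: ler_sum => k _.
    by rewrite exprMn sqrrN sqrr_sign mul1r boolXX.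
  rewrite big1 ?add0r => [|w _]; last by rewrite expr0n.
  case: (le_h p q); last by rewrite big1 // => *; rewrite expr0n.
  apply: (@le_trans _ _ (1 + 1)) => //.
  apply: le_trans (lerD (slot_sum1 (h q.1 q.2)) (slot_sum1 (h p.1 p.2))).
  rewrite -big_split; apply: ler_sum => k _ /=.
  by case: (_ == _); case: (_ == _).
- by case: i => [[u v]|//] /=; case: (~~ _).
- rewrite AE /=; case: eqVneq => //= /pair0; case: (E u v) => /=.
    by rewrite expr1 mulN1r oppr_ge0 subr_le0.
  by rewrite expr0 mul1r lerBrDl.
- by rewrite AE /=; case: ifP => // /le0; rewrite subr_ge0.
have cardJ : #|J| = (#|V| + m)%N by rewrite card_sum card_ord.
exists (y \o inl), (y \o inr); split=> [|u|i]; [|by rewrite /= -cardJ|by rewrite /= -cardJ].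
split=> [u v uv|p q pq].
  have := feas (inl (u, v)); rewrite AE /= (negPf uv) /=; case: (E u v) => /=.
    by rewrite expr1 mulN1r oppr_ge0 subr_le0.
  by rewrite expr0 mul1r lerBrDl.
by have := feas (inr (p, q)); rewrite AE pq subr_ge0.
Qed.
End LinearAlgebra.

(** * Rooted trees *)

Lemma dist_le (T : sgraph) (x : T) (p : seq T) :
  path (@adj T) x p -> dist x (last x p) <= size p.
Proof.
move=> xp; case: (ltnP (size p) #|T|) => [lt_p|le_p]; last first.
  by apply: leq_trans (find_size _ _) _; rewrite size_iota.
rewrite leqNgt; apply/negP => /(before_find 0).
rewrite nth_iota // add0n => /negbT/negP; apply.
by apply/existsP; exists (in_tuple p); rewrite /= xp eqxx.
Qed.

(** A walk shortens to one without repetitions, which has fewer than [#|T|] edges, so the search in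
    [dist] succeeds. *)
Lemma dist_path (T : sgraph) (x y : T) : connect (@adj T) x y ->
  exists p, [/\ path (@adj T) x p, last x p = y & size p = dist x y].
Proof.
case/connectP=> p xp ->; case/shortenP: xp => q xq uq _ {p}.
have lt_q : size q < #|T| by rewrite (leq_trans _ (max_card [in x :: q])) // (card_uniqP uq).
have hasq : has (fun d => walk d x (last x q)) (iota 0 #|T|).
  apply/hasP; exists (size q); first by rewrite mem_iota.
  by apply/existsP; exists (in_tuple q); rewrite /= xq eqxx.
have /existsP[p /andP[xp /eqP lp]] := nth_find 0 hasq.
move: p xp lp; rewrite nth_iota ?add0n => [p xp lp|]; last first.
  by rewrite -[X in _ < X](size_iota 0) -has_find.
by exists p; rewrite size_tuple.
Qed.

(** The guards [0 < l _] keep the value of [p] at the root from creating an edge. These conditions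
    force [T] to be connected and acyclic, so they serve for given trees and constructed ones
    alike. *)
Definition rooted (T : sgraph) (r : T) (l : T -> nat) (p : T -> T) : Prop :=
  [/\ forall x y, adj x y = (0 < l x) && (p x == y) || (0 < l y) && (p y == x),
      forall x, l (p x) = (l x).-1
    & forall x, l x = 0 -> x = r].

(* The ancestor of x at level t; it is x itself when t exceeds the level of x. *)
Definition ancestor (T : sgraph) (l : T -> nat) (p : T -> T) (t : nat) (x : T) : T :=
  iter (l x - t) p x.

Section Rooted.
Variables (T : sgraph) (r : T) (l : T -> nat) (p : T -> T).
Hypothesis rT : rooted r l p.

Lemma adj_parent x : 0 < l x -> adj x (p x).
Proof. by move=> lx; case: rT => -> _ _; rewrite lx eqxx. Qed.

Lemma level_iter i x : l (iter i p x) = l x - i.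
Proof. by case: rT => _ lvp _; elim: i => [|i IH]; rewrite ?subn0 //= lvp IH subnS. Qed.

Lemma ancestor_self x : ancestor l p (l x) x = x.
Proof. by rewrite /ancestor subnn. Qed.

Lemma ancestor_parent t x : t < l x -> ancestor l p t (p x) = ancestor l p t x.
Proof.
case: rT => _ lvp _ ltx; rewrite /ancestor lvp -iterSr.
by have -> : ((l x).-1 - t).+1 = l x - t by lia.
Qed.

Lemma parent_ancestor t x : t < l x -> p (ancestor l p t.+1 x) = ancestor l p t x.
Proof. by move=> ltx; rewrite /ancestor -iterS subnSK. Qed.

Lemma path_ancestor x i : i <= l x ->
  exists q, [/\ path (@adj T) x q, last x q = iter i p x & size q = i].
Proof.
elim: i x => [|i IH] x ltx; first by exists [::].
have [|q [xq lq sq]] := IH (p x); first by case: rT => _ -> _; lia.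
exists (p x :: q); rewrite /= adj_parent; last lia.
by rewrite xq lq sq -iterSr.
Qed.

Lemma rooted_connected : connected T.
Proof.
have cr x : connect (@adj T) x r.
  have [q [xq lq _]] := path_ancestor (leqnn (l x)).
  apply/connectP; exists q => //; rewrite lq.
  by case: rT => _ _ /(_ (iter (l x) p x)) ->; rewrite // level_iter subnn.
move=> x y; apply: connect_trans (cr x) _.
by rewrite (sym_connect_sym (@adj_sym T)).
Qed.

(** On a cycle, both neighbours of a vertex of maximal level are its parent, hence equal. *)
Lemma rooted_acyclic : acyclic T.
Proof.
case: rT => adjE lvp _ c cc uc; rewrite leqNgt; apply/negP => sc.
have [x xc maxx] : exists2 x, x \in c & forall y, y \in c -> l y <= l x.
  case: c sc {cc uc} => // x0 c _.
  case: (@arg_maxnP _ x0 [in x0 :: c] l (mem_head _ _)) => x xc maxx.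
  by exists x.
have parent_of y : y \in c -> adj x y -> y = p x.
  move=> /maxx le_yx; rewrite adjE => /orP[/andP[_ /eqP]|/andP[y0 /eqP px]] //.
  by have := lvp y; rewrite px; lia.
have [i s def_c] := rot_to xc.
have mem_s y : y \in s -> y \in c by rewrite -(mem_rot i c) def_c inE orbC => ->.
move: cc uc sc; rewrite -(rot_cycle i) -(rot_uniq i c) -(size_rot i c) def_c.
case: s mem_s {def_c} => // y [|z s] // mem_s.
rewrite /= rcons_path => /and3P[xy _ /andP[_]].
rewrite adj_sym => /parent_of last_s /and3P[_ /negP yzs _] _; apply: yzs.
rewrite (parent_of y) ?mem_s ?mem_head // -last_s ?mem_last //.
by rewrite mem_s // inE mem_last orbT.
Qed.

(* 2 q is the excess of the walk w over the walk through the ancestors at level t. *)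
Lemma path_common_ancestor x w : path (@adj T) x w ->
  exists t q, [/\ t <= l x, t <= l (last x w),
    ancestor l p t x = ancestor l p t (last x w)
    & size w + t.*2 = l x + l (last x w) + q.*2].
Proof.
case: rT => adjE lvp _.
elim: w x => [|x' w IH] x; first by exists (l x), 0; split=> //=; lia.
rewrite /= adjE => /andP[xx' /IH[t [q [tx' ty anc_t sz]]]].
case/orP: xx' => /andP[l0 /eqP px].
  (* The walk starts upwards: meeting level and excess are unchanged. *)
  have lx' := lvp x; rewrite px in lx'.
  exists t, q; split=> //; try lia.
  by rewrite -anc_t -px ancestor_parent //; lia.
have lx := lvp x'; rewrite px in lx.
(* The walk starts downwards: either it moves away from the meeting ancestor, which adds 1 to [q],
   or [x'] is itself an ancestor of the end and [x] becomes the meeting vertex. *)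
have [tx | tx] := leqP t (l x).
  exists t, q.+1; split=> //; try lia.
  by rewrite -anc_t -px ancestor_parent //; lia.
have def_t : t = (l x).+1 by lia.
exists (l x), q; split=> //; try lia.
rewrite ancestor_self -[RHS]parent_ancestor -?def_t // -anc_t.
have -> : t = l x' by lia.
by rewrite ancestor_self.
Qed.

(** Climb from [x] to the common ancestor, then descend to [y]. *)
Lemma dist_ancestor x y t : t <= l x -> t <= l y ->
  ancestor l p t x = ancestor l p t y -> dist x y + t.*2 <= l x + l y.
Proof.
move=> tx ty anc_t.
have [p1 [xp1 l1 s1]] := path_ancestor (leq_subr t (l x)).
have [p2 [yp2 l2 s2]] := path_ancestor (leq_subr t (l y)).
have last12 : last x p1 = last y p2 by rewrite l1 l2.
have xw : path (@adj T) x (p1 ++ rev (belast y p2)).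
  rewrite cat_path xp1 last12 rev_path.
  by rewrite (eq_path (e' := @adj T)) // => a b; rewrite adj_sym.
have := dist_le xw; rewrite last_cat last12.
have -> : last (last y p2) (rev (belast y p2)) = y.
  by case: {+}p2 => //= z p3; rewrite rev_cons last_rcons.
by rewrite size_cat size_rev size_belast; lia.
Qed.

(** A shortest walk has excess 0, by comparison with the walk through the common ancestor. *)
Lemma dist_rooted x y : exists t, [/\ t <= l x, t <= l y,
  ancestor l p t x = ancestor l p t y & dist x y + t.*2 = l x + l y].
Proof.
have [w [xw lw sw]] := dist_path (rooted_connected x y).
have [t [q [tx ty anc_t sz]]] := path_common_ancestor xw.
rewrite lw in ty anc_t sz; exists t; split=> //.
by have := dist_ancestor tx ty anc_t; lia.
Qed.
End Rooted.

(** * Rooting a tree by the distance to a chosen vertex *)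

Section TreeRooted.
Variables (T : sgraph) (r : T).
Hypotheses (connT : connected T) (acycT : acyclic T).

Lemma dist_refl : dist r r = 0.
Proof. by apply/eqP; rewrite -leqn0; apply: (@dist_le T r [::]). Qed.

Lemma dist_eq0 x : dist r x = 0 -> x = r.
Proof.
by have [w [_ <- sw]] := dist_path (connT r x); rewrite -sw => /size0nil->.
Qed.

Lemma dist_adj x y : adj x y -> dist r y <= (dist r x).+1.
Proof.
move=> xy; have [w [rw lw <-]] := dist_path (connT r x).
have := @dist_le T r (rcons w y); rewrite rcons_path last_rcons size_rcons lw rw.
exact.
Qed.

Lemma neighbor_towards_root x : 0 < dist r x ->
  exists2 y, adj x y & dist r x = (dist r y).+1.
Proof.
have [w [rw lw sw]] := dist_path (connT r x).
case/lastP: w rw lw sw => [|w z]; first by move=> _ _ <-.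
rewrite rcons_path last_rcons size_rcons => /andP[rw wz] zx sw _.
rewrite {}zx in wz; exists (last r w); first by rewrite adj_sym.
have := dist_le rw; have := dist_adj wz; lia.
Qed.

(** A path from [y] to [y'] avoiding [x] would close up through [x] to a cycle with at least three
    vertices. *)
Lemma acyclic_neighbors_apart x y y' : adj x y -> adj x y' -> y != y' ->
  ~~ connect (fun a b : T => [&& adj a b, a != x & b != x]) y y'.
Proof.
move=> xy xy' neq_y; apply/negP => /connectP[w0].
case/shortenP=> w yw uw _ def_y'.
have xw : x \notin y :: w.
  rewrite inE negb_or; apply/andP; split.
    by apply: contraTneq xy => ->; rewrite adj_irr.
  elim: w y {xy neq_y uw def_y'} yw => //= z w IH y /andP[/and3P[_ _ zx] zw].
  by rewrite inE negb_or eq_sym zx (IH z).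
have := acycT (c := x :: y :: w); rewrite /cycle rcons_cons /= xy rcons_path /=.
rewrite -def_y' (adj_sym y') xy' andbT -/(uniq (y :: w)) uw xw.
have -> : path (@adj T) y w by apply: sub_path yw => a b /and3P[].
by case: w {yw uw xw} def_y' => [def_y'|z w _ /(_ isT isT)]; rewrite ?def_y' ?eqxx // in neq_y *.
Qed.

(** Both neighbours reach the root while avoiding [x], so they would be joined away from [x].
    Allowing equal distances also rules out edges inside a level. *)
Lemma acyclic_parent_unique x y y' :
  adj x y -> adj x y' -> dist r y <= dist r x -> dist r y' <= dist r x ->
  x != r -> y = y'.
Proof.
move=> xy xy' yx y'x xr; apply/eqP; apply: contraT => neq_y.
(* Each step towards the root lands strictly closer to it than [x], so [x] is never met. *)
suff to_r d z : dist r z <= d -> z != x -> dist r z <= dist r x ->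
    connect (fun a b : T => [&& adj a b, a != x & b != x]) z r.
  have neq_x z : adj x z -> z != x.
    by move=> xz; apply: contraTneq xz => ->; rewrite adj_irr.
  have := acyclic_neighbors_apart xy xy' neq_y; apply: contraNT => _.
  apply: connect_trans (to_r _ y (leqnn _) (neq_x _ xy) yx) _.
  rewrite sym_connect_sym ?(to_r _ y' (leqnn _) (neq_x _ xy') y'x) //.
  by move=> a b; rewrite adj_sym [(a != x) && _]andbC.
elim: d z => [|d IH] z zd zx z_le.
  by rewrite (@dist_eq0 z) ?connect0 //; lia.
have [->|z_r] := eqVneq z r; first exact: connect0.
have [|z' zz' def_d] := @neighbor_towards_root z.
  by rewrite lt0n; apply: contra_neq z_r; apply: dist_eq0.
have z'x : z' != x by apply: contra_eqN def_d => /eqP->; lia.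
apply: connect_trans (connect1 _) (IH z' _ z'x _); rewrite ?zz' ?zx //; lia.
Qed.

Definition tree_parent (x : T) : T :=
  if [pick y | adj x y & dist r x == (dist r y).+1] is Some y then y else x.

Lemma tree_rooted : rooted r (dist r) tree_parent.
Proof.
have parentP x : 0 < dist r x ->
    adj x (tree_parent x) /\ dist r x = (dist r (tree_parent x)).+1.
  move=> /neighbor_towards_root[y xy def_d]; rewrite /tree_parent.
  by case: pickP => [z /andP[? /eqP]|/(_ y)] //=; rewrite xy def_d eqxx.
have parent_adj x y : adj x y -> dist r y <= dist r x ->
    (0 < dist r x) && (tree_parent x == y).
  move=> xy yx.
  have x0 : 0 < dist r x.
    rewrite lt0n; apply: contraTneq xy => x0.
    by rewrite (dist_eq0 x0) (@dist_eq0 y) ?adj_irr //; lia.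
  have [xp def_d] := parentP _ x0; rewrite x0 /=; apply/eqP.
  apply: acyclic_parent_unique xp xy _ yx _; first lia.
  by apply: contraTneq x0 => ->; rewrite dist_refl.
split=> [x y|x|]; last exact: dist_eq0.
  apply/idP/orP => [xy|[] /andP[/parentP[? _] /eqP<-] //]; last by rewrite adj_sym.
  have [yx|xy'] := leqP (dist r y) (dist r x).
    by left; apply: parent_adj.
  by right; apply: parent_adj; rewrite 1?adj_sym // ltnW.
have [x0|/parentP[_ ->] //] := posnP (dist r x).
rewrite /tree_parent; case: pickP => [z /andP[_ /eqP]|_]; lia.
Qed.
End TreeRooted.

(** * The tree of an ultrametric similarity *)

Section UltrametricTree.
Variables (V : finType) (g : V -> V -> nat) (u0 v0 : V).
Hypotheses (gC : forall u v, g u v = g v u)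
  (gU : forall u v w, minn (g u v) (g v w) <= g u w)
  (gD : forall u v, u != v -> g u v < g u u)
  (neq0 : u0 != v0) (g0 : g u0 v0 = 0).

Let height := \max_u g u u.

(* The nodes are the classes of the pairs (u, t) with t <= g u u, where (u, t) and
   (v, t) are identified when t <= g u v; u is the leaf (u, g u u). *)
Definition class_repr (u : V) (t : nat) : V := odflt u [pick v | t <= g u v].

Definition is_node (x : V * 'I_height.+1) : bool :=
  (x.2 <= g x.1 x.1) && (class_repr x.1 x.2 == x.1).

Definition node_type : finType := {x : V * 'I_height.+1 | is_node x}.

(** As the levels differ by one, the minimum is the level of the upper node. *)
Definition node_adj (x y : node_type) : bool :=
  (minn (val x).2 (val y).2 <= g (val x).1 (val y).1)
  && (((val x).2 == (val y).2.+1 :> nat) || ((val y).2 == (val x).2.+1 :> nat)).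

Lemma node_adj_sym : symmetric node_adj.
Proof. by move=> x y; rewrite /node_adj gC minnC orbC. Qed.

Lemma node_adj_irr : irreflexive node_adj.
Proof. by move=> x; rewrite /node_adj; case: eqP; rewrite ?andbF //; lia. Qed.

Definition ultra_tree : sgraph := SGraph node_adj_sym node_adj_irr.

Lemma g_trans t u v w : t <= g u v -> t <= g v w -> t <= g u w.
Proof. by move=> uv vw; apply: leq_trans (gU u v w); rewrite leq_min uv. Qed.

Lemma g_le_diag u v : g u v <= g u u.
Proof. by have [->|/gD/ltnW] := eqVneq u v. Qed.

Lemma class_repr_le t u : t <= g u u -> t <= g u (class_repr u t).
Proof. by rewrite /class_repr; case: pickP. Qed.

(** [pick] depends only on the extension of its predicate, so equivalent pairs get the same
    representative; [v] itself qualifies, so the default is not reached. *)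
Lemma class_repr_eq t u v : t <= g u v -> class_repr u t = class_repr v t.
Proof.
move=> uv; rewrite /class_repr (eq_pick (Q := fun w => t <= g v w)).
  by case: pickP => // /(_ v) /negP[]; rewrite (leq_trans uv) // gC g_le_diag.
by move=> w; apply/idP/idP; apply: g_trans; rewrite // gC.
Qed.

Lemma root_is_node : is_node (class_repr u0 0, ord0).
Proof. by rewrite /is_node /= (@class_repr_eq 0 _ u0) ?eqxx. Qed.

(** Meaningful for [t <= g u u]; [insubd] makes it total, with the root as default. *)
Definition node (u : V) (t : nat) : ultra_tree :=
  insubd (Sub _ root_is_node : node_type) (class_repr u t, inord t).

Definition level (x : ultra_tree) : nat := (val (x : node_type)).2.

Lemma val_node u t : t <= g u u ->
  val (node u t : node_type) = (class_repr u t, inord t).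
Proof.
move=> tu; have ut := class_repr_le tu.
have inordt : (inord t : 'I_height.+1) = t :> nat.
  by rewrite inordK // ltnS (leq_trans tu) // (bigmax_sup u).
rewrite val_insubd /is_node /= inordt.
by rewrite (class_repr_eq (v := u)) ?eqxx ?andbT 1?gC // (leq_trans ut) // gC g_le_diag.
Qed.

Lemma level_node u t : t <= g u u -> level (node u t) = t.
Proof.
move=> tu; rewrite /level val_node // inordK // ltnS (leq_trans tu) //.
exact: (bigmax_sup u).
Qed.

Lemma level_le_diag (x : ultra_tree) :
  level x <= g (val (x : node_type)).1 (val (x : node_type)).1.
Proof. by case/andP: (valP (x : node_type)). Qed.

Lemma nodeK (x : ultra_tree) : node (val (x : node_type)).1 (level x) = x.
Proof.
apply: (val_inj : injective (val : node_type -> _)).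
rewrite val_node ?level_le_diag //.
case/andP: (valP (x : node_type)) => _ /eqP; rewrite /level inord_val => ->.
by case: (val _).
Qed.

Lemma nodeP (x : ultra_tree) : exists u t, t <= g u u /\ x = node u t.
Proof.
exists (val (x : node_type)).1, (level x); split; first exact: level_le_diag.
by rewrite nodeK.
Qed.

Lemma node_eq u v t s : t <= g u u -> s <= g v v ->
  (node u t == node v s) = (t == s) && (t <= g u v).
Proof.
move=> tu sv; apply/eqP/andP => [eq_x|[/eqP ts uv]].
  have ts : t = s by rewrite -(level_node tu) eq_x level_node.
  split; first exact/eqP.
  have := congr1 val eq_x; rewrite !val_node // => -[eq_r _].
  apply: g_trans (class_repr_le tu) _; rewrite eq_r gC ts.
  exact: class_repr_le.
apply: (val_inj : injective (val : node_type -> _)).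
by rewrite !val_node // -ts (class_repr_eq uv).
Qed.

Lemma adj_node u v t s : t <= g u u -> s <= g v v ->
  adj (node u t) (node v s)
  = (minn t s <= g u v) && ((t == s.+1) || (s == t.+1)).
Proof.
move=> tu sv; have := level_node sv; have := level_node tu.
rewrite /level /= /node_adj => -> ->; congr (_ && _).
rewrite !val_node //=.
have ur : minn t s <= g u (class_repr u t).
  by rewrite (leq_trans (geq_minl _ _)) ?class_repr_le.
have vr : minn t s <= g v (class_repr v s).
  by rewrite (leq_trans (geq_minr _ _)) ?class_repr_le.
apply/idP/idP => h.
  by apply: g_trans ur _; apply: g_trans h _; rewrite gC.
by apply: g_trans vr; apply: g_trans h; rewrite gC.
Qed.

Definition node_parent (x : ultra_tree) : ultra_tree :=
  node (val (x : node_type)).1 (level x).-1.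

Lemma parent_node u t : t <= g u u -> node_parent (node u t) = node u t.-1.
Proof.
move=> tu; rewrite /node_parent level_node //.
apply/eqP; rewrite node_eq ?eqxx //=.
- rewrite val_node //= gC (leq_trans (leq_pred t)) // class_repr_le //.
- by rewrite (leq_trans (leq_pred t)) // -{1}(level_node tu) level_le_diag.
- by rewrite (leq_trans (leq_pred t)).
Qed.

Lemma iter_parent_node i u t : t <= g u u ->
  iter i node_parent (node u t) = node u (t - i).
Proof.
move=> tu; elim: i => [|i IH]; first by rewrite subn0.
by rewrite iterS IH parent_node ?subnS //; lia.
Qed.

Lemma ultra_tree_rooted : rooted (node u0 0) level node_parent.
Proof.
split=> [x y|x|x].
- have [u [t [tu ->]]] := nodeP x; have [v [s [sv ->]]] := nodeP y.
  rewrite adj_node // !parent_node // !level_node // !node_eq //; try lia.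
  rewrite (gC v u); case: (ltngtP t s) => ts; rewrite ?andbF //=; try lia.
- have [u [t [tu ->]]] := nodeP x.
  by rewrite parent_node // !level_node //; lia.
have [u [t [tu ->]]] := nodeP x; rewrite level_node // => t0.
apply/eqP; rewrite node_eq // t0 //.
Qed.

Lemma ultra_tree_is_tree : is_tree ultra_tree.
Proof.
split; last exact: rooted_acyclic ultra_tree_rooted.
  by apply/card_gt0P; exists (node u0 0).
exact: rooted_connected ultra_tree_rooted.
Qed.

Definition leaf_node (u : V) : ultra_tree := node u (g u u).

Lemma leaf_node_inj : injective leaf_node.
Proof.
move=> u v /eqP; rewrite node_eq // => /andP[_]; apply: contraTeq => /gD.
by rewrite -ltnNge.
Qed.

(** Two leaves share their ancestor at level [t] exactly when [t <= g u v], so their deepest common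
    ancestor lies at level [g u v]. *)
Lemma dist_leaf_node u v :
  dist (leaf_node u) (leaf_node v) + (g u v).*2 = g u u + g v v.
Proof.
have uv : g u v <= g v v by rewrite gC g_le_diag.
have anc t w : t <= g w w -> ancestor level node_parent t (leaf_node w) = node w t.
  by move=> tw; rewrite /ancestor iter_parent_node // level_node // subKn.
have [t] := dist_rooted ultra_tree_rooted (leaf_node u) (leaf_node v).
rewrite !level_node // => -[tu tv]; rewrite !anc // => /eqP.
rewrite node_eq // => /andP[_ t_uv] def_d.
have := @dist_ancestor _ _ _ _ ultra_tree_rooted (leaf_node u) (leaf_node v) (g u v).
rewrite !level_node // !anc ?g_le_diag // => /(_ isT uv) le_d.
suff: node u (g u v) = node v (g u v) by move/le_d; lia.
by apply/eqP; rewrite node_eq ?eqxx ?g_le_diag //=.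
Qed.

(** By [gD] the class of [u] at level [g u u] contains only [u], so it has no child. As [u0] and
    [v0] separate at level 0, the root has two children and is not a leaf. *)
Lemma leaves_ultra_tree : leaves ultra_tree = [set leaf_node u | u : V].
Proof.
(* By the ultrametric inequality, [u] cannot be in a common branch with both [u0] and [v0]. *)
have other u : exists2 w, u != w & g u w = 0.
  have [->|neq_u] := eqVneq u u0; first by exists v0.
  have := gU u0 u v0; rewrite g0 leqn0 => /eqP min0.
  have [uu0|uv0] : g u0 u = 0 \/ g u v0 = 0 by lia.
    by exists u0; rewrite // gC.
  exists v0 => //; apply/eqP => uv; rewrite uv in uv0.
  by have := @gD v0 u0; rewrite eq_sym neq0 uv0 => /(_ isT).
have pos u : 0 < g u u by have [w /gD] := other u; lia.
apply/setP=> x; rewrite inE; apply/cards1P/imsetP => [[z def_z]|[u _ ->]].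
  have [u [t [tu def_x]]] := nodeP x.
  exists u => //; rewrite def_x /leaf_node; congr node.
  have nb v s : s <= g v v -> minn t s <= g u v ->
      (t == s.+1) || (s == t.+1) -> node v s = z.
    by move=> sv uv ts; apply/set1P; rewrite -def_z inE def_x adj_node // uv.
  apply/eqP; rewrite eqn_leq tu leqNgt; apply/negP => lt_t.
  have zt : node u t.+1 = z by apply: nb; rewrite ?eqxx ?orbT //; lia.
  (* Besides its child towards [u], the node has a second child if it is the root, and a parent
     otherwise. *)
  case: t => [|t] in tu def_x nb lt_t zt *.
    have [w neq_w uw] := other u.
    have zw : node w 1 = z by apply: nb; rewrite ?min0n.
    by move/eqP: zt; rewrite -zw node_eq // uw.
  have zt' : node u t = z by apply: nb; rewrite ?eqxx //; lia.
  by move/eqP: zt; rewrite -zt' node_eq //; lia.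
exists (node u (g u u).-1); apply/setP=> y; rewrite !inE.
have [v [s [sv ->]]] := nodeP y.
have u0' := pos u.
rewrite adj_node // node_eq //; last lia.
apply/andP/andP => [[uv ts]|[/eqP def_s uv]].
  have [eq_uv|/gD lt_uv] := eqVneq u v; first by rewrite -eq_uv in sv *; lia.
  by rewrite gC; lia.
by rewrite gC; lia.
Qed.

Lemma ultrametric_realization : exists (T : sgraph) (f : V -> T),
  [/\ is_tree T, injective f, leaves T = [set f u | u : V]
    & forall u v, dist (f u) (f v) + (g u v).*2 = g u u + g v v].
Proof.
exists ultra_tree, leaf_node; split.
- exact: ultra_tree_is_tree.
- exact: leaf_node_inj.
- exact: leaves_ultra_tree.
exact: dist_leaf_node.
Qed.
End UltrametricTree.

(** * The bound on the leaf rank *)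

(** [M] is the Gromov product at [r], the deepest level at which the ancestors agree. Agreement at a
    level is transitive, whence the ultrametric inequality. *)
Lemma tree_meet_depth (T : sgraph) (r : T) : is_tree T ->
  exists M : T -> T -> nat,
    [/\ forall x y, M x y = M y x,
        forall x y z, minn (M x y) (M y z) <= M x z,
        forall x y, dist x y + (M x y).*2 = dist r x + dist r y
      & forall x, M r x = 0].
Proof.
case=> _ connT acycT; have rT := @tree_rooted T r connT acycT.
pose l := dist r; pose p := tree_parent r.
pose M x y := (l x + l y - dist x y)./2.
have MP x y : [/\ M x y <= l x, M x y <= l y,
    ancestor l p (M x y) x = ancestor l p (M x y) y
    & dist x y + (M x y).*2 = l x + l y].
  have [t [tx ty anc_t def_d]] := dist_rooted rT x y.
  suff -> : M x y = t by [].
  by rewrite /M -def_d addKn doubleK.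
have M_max x y t : t <= l x -> t <= l y ->
    ancestor l p t x = ancestor l p t y -> t <= M x y.
  move=> tx ty anc_t; have [_ _ _ def_d] := MP x y.
  have := dist_ancestor rT tx ty anc_t; rewrite -/l; lia.
have anc_le x s t : t <= s -> s <= l x ->
    ancestor l p t x = iter (s - t) p (ancestor l p s x).
  by move=> ts sx; rewrite /ancestor -iterD; congr (iter _ _ _); lia.
have anc_M x y t : t <= M x y -> ancestor l p t x = ancestor l p t y.
  move=> tM; have [Mx My anc_xy _] := MP x y.
  by rewrite (anc_le x _ _ tM) // (anc_le y _ _ tM) // anc_xy.
exists M; split=> [x y|x y z|x y|x].
- have [xy1 xy2 xy3 _] := MP x y; have [yx1 yx2 yx3 _] := MP y x.
  by apply/eqP; rewrite eqn_leq !M_max.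
- have [Mxy _ _ _] := MP x y; have [_ Myz _ _] := MP y z.
  apply: M_max; [lia|lia|].
  by rewrite (anc_M x y) ?geq_minl // (anc_M y z) ?geq_minr.
- by have [_ _ _] := MP x y.
by have [+ _ _ _] := MP r x; rewrite /l dist_refl leqn0 => /eqP.
Qed.

(** A vertex farthest from [r] is a leaf: a neighbour other than its parent would be farther. *)
Lemma tree_other_leaf (T : sgraph) (r : T) : is_tree T -> r \in leaves T ->
  exists2 y, y \in leaves T & y != r.
Proof.
case=> _ connT acycT; rewrite inE => /cards1P[x r_x].
have rx : adj r x by have := set11 x; rewrite -r_x inE.
have := @tree_rooted T r connT acycT; have := @adj_parent T r (dist r) (tree_parent r).
set p := tree_parent r => adj_p rT; have [adjE lvp _] := rT.
have [y _ maxy] := @arg_maxnP T r predT (dist r) isT.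
have y0 : 0 < dist r y.
  apply: leq_trans (maxy x isT); rewrite lt0n; apply: contraTneq rx => x0.
  by rewrite (dist_eq0 connT x0) adj_irr.
exists y; last by apply: contraTneq y0 => ->; rewrite dist_refl.
rewrite inE; apply/cards1P; exists (p y); apply/setP => w; rewrite !inE.
apply/idP/eqP => [|->]; last exact: adj_p.
rewrite adjE => /orP[/andP[_ /eqP]|/andP[w0 /eqP pw]] //.
by have := lvp w; rewrite pw; have := maxy w isT; rewrite /geq /=; lia.
Qed.

(** A new point [x] adds at most one value, its largest similarity [M x y1]: any other [M x v]
    equals [M y1 v]. *)
Lemma ultrametric_values (V : finType) (M : V -> V -> nat) :
  (forall u v, M u v = M v u) ->
  (forall u v w, minn (M u v) (M v w) <= M u w) ->
  forall s : seq V, s != [::] -> exists2 t : seq nat, size t < size s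
    & {in s &, forall u v, u != v -> M u v \in t}.
Proof.
move=> MC MU; elim=> // x s IH _.
case: (altP (s =P [::])) => [->|s0].
  by exists [::] => // u v; rewrite !inE => /eqP-> /eqP->; rewrite eqxx.
have [t lt_t inM] := IH s0.
have [y ys] : exists y, y \in s by case: s s0 {IH lt_t inM} => // y s; exists y; apply: mem_head.
have [y1 y1s maxy] := @arg_maxnP _ y [in s] (M x) ys.
exists (M x y1 :: t) => //.
have Mx v : v \in s -> M x v \in M x y1 :: t.
  move=> vs; rewrite inE.
  have [eqM|neM] := eqVneq (M x v) (M x y1); first by rewrite ?eqM ?eqxx.
  have le_v : M x v <= M x y1 := maxy v vs.
  (* An ultrametric triangle is isosceles: the two smallest values agree. *)
  have -> : M x v = M y1 v.
    have := MU y1 x v; have := MU x y1 v; rewrite (MC y1 x); lia.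
  rewrite inM ?orbT //; apply: contraNneq neM => ->; exact: eqxx.
move=> u v; rewrite !in_cons => /predU1P[->|us] /predU1P[->|vs]; rewrite ?eqxx //.
- by move=> _; apply: Mx.
- by move=> _; rewrite MC; apply: Mx.
by move=> uv; rewrite inM ?orbT.
Qed.

Section Rescaling.
Import Order.TTheory GRing.Theory Num.Theory.

Lemma leaf_root_rescaling (G : sgraph) (k : nat) : 1 < #|G| -> has_leaf_root k G ->
  has_leaf_root (6 * 2 ^ (2 * #|G|).-1 + 2) G.
Proof.
move=> G1 [T [treeT [f [f_inj leavesT adj_dist]]]].
have /card_gt1P[z [z' [_ _ neq_z]]] := G1.
have [M0 [M0C M0U M0D M0z]] := @tree_meet_depth T (f z) treeT.
pose l u := dist (f z) (f u); pose M u v := M0 (f u) (f v).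
have MC u v : M u v = M v u by apply: M0C.
have MU u v w : minn (M u v) (M v w) <= M u w by apply: M0U.
have MD u v : dist (f u) (f v) + (M u v).*2 = l u + l v by apply: M0D.
have Mz u : M z u = 0 by apply: M0z.
have [|s lt_s sM] := @ultrametric_values G M MC MU (enum G).
  by rewrite -size_eq0 -lt0n -cardE ltnW.
have {}lt_s : size s < #|G| by rewrite cardE.
have {}sM u v : u != v -> M u v \in s by apply: sM; rewrite mem_enum.
(* Pairs meeting at the root get [None], which pins their value to 0; this keeps the new values
   nonnegative and the root of the new tree branching. *)
pose h u v := if M u v == 0 then None else [pick i : 'I_(size s) | nth 0 s i == M u v].
have hM u v : u != v ->
    slot_value (fun i : 'I_(size s) => Posz (4 * nth 0 s i)) (h u v) = Posz (4 * M u v).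
  move=> /sM /(nthP 0)[i lt_i def_M]; rewrite /h; case: eqP => [->|_] //.
  by case: pickP => [j /eqP def_j|/(_ (Ordinal lt_i))]; rewrite /= ?def_j // def_M eqxx.
pose le_h (p q : G * G) :=
  [&& p.1 != p.2, q.1 != q.2 & M p.1 p.2 <= M q.1 q.2].
(* Everything is doubled so that the initial weights l u - k / 2 are integers. *)
have [|a [c [[adj_ac le_c] a_le c_le]]] := @small_weights G (@adj G) _ h le_h
    (fun u => Posz (2 * l u) - Posz k)%R (fun i => Posz (4 * nth 0 s i)).
  split=> [u v uv|p q /and3P[p12 q12 Mpq]]; last by rewrite !hM // lez_nat; lia.
  rewrite hM //; have := MD u v; have := adj_dist _ _ uv.
  by case: (adj u v); lia.
(* The number of unknowns is [#|G| + size s], at most [2 * #|G| - 1]. *)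
pose B := 2 ^ (2 * #|G|).-1.
have pow_le : ((Posz 2) ^+ (#|G| + size s) <= Posz B)%R.
  rewrite -[Posz 2]natz -natrX natz lez_nat /B leq_exp2l //; lia.
have a_leB u : (`|a u| <= Posz B)%R := le_trans (a_le u) pow_le.
have c_leB i : (`|c i| <= Posz B)%R := le_trans (c_le i) pow_le.
pose H u v := slot_value c (h u v).
have H_ge0 u v : u != v -> (0 <= H u v)%R.
  move=> uv; have -> : 0%R = H z z' by rewrite /H /h Mz.
  by apply: (le_c (z, z') (u, v)); rewrite /le_h /= neq_z uv Mz.
have H_le u v : (H u v <= Posz B)%R.
  rewrite /H; case: (h u v) => [i|] //=.
  by have := c_leB i; lia.
have H_mono u v u' v' : u != v -> u' != v' -> M u v <= M u' v' ->
    (H u v <= H u' v')%R.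
  by move=> uv uv' le_M; apply: (le_c (u, v) (u', v')); rewrite /le_h /= uv uv'.
(* The new distance is [6 * B + 2 + 2 * (a u + a v - H u v)], which compares to [6 * B + 2] as
   [a u + a v] does to [H u v]. The shift [3 * B + 1] makes leaf depths at least [B + 1], beyond all
   meets. *)
pose g u v := if u == v then `|(2 * a u + Posz (3 * B + 1))%R|%N else `|H u v|%N.
have g_diag u : Posz (g u u) = (2 * a u + Posz (3 * B + 1))%R.
  by rewrite /g eqxx; have := a_leB u; lia.
have g_off u v : u != v -> Posz (g u v) = H u v.
  by move=> uv; rewrite /g (negPf uv); have := H_ge0 _ _ uv; lia.
have gC u v : g u v = g v u.
  by rewrite /g eq_sym; case: eqP => [->|_] //; rewrite /H /h MC.
have gD u v : u != v -> g u v < g u u.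
  move=> uv; have := g_off _ _ uv; have := g_diag u; have := H_le u v.
  by have := a_leB u; lia.
have gU u v w : minn (g u v) (g v w) <= g u w.
  have [->|uv] := eqVneq u v; first exact: geq_minr.
  have [->|vw] := eqVneq v w; first exact: geq_minl.
  have [<-|uw] := eqVneq u w; first by rewrite (leq_trans (geq_minl _ _)) // ltnW ?gD.
  have := g_off _ _ uv; have := g_off _ _ vw; have := g_off _ _ uw.
  have := MU u v w; rewrite geq_min => /orP[] /H_mono; [move/(_ uv uw)|move/(_ vw uw)]; lia.
have g0 : g z z' = 0.
  by rewrite /g (negPf neq_z) /H /h Mz.
have [T' [f' [treeT' f'_inj leavesT' dist_f']]] :=
  ultrametric_realization gC gU gD neq_z g0.
exists T'; split=> //; exists f'; split=> // u v uv.
have := dist_f' u v; have := g_diag u; have := g_diag v; have := g_off _ _ uv.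
have := adj_ac u v uv; rewrite -/(H u v) -/B; case: (adj u v); lia.
Qed.
End Rescaling.

(** The one-vertex tree has no leaves. *)
Lemma leaf_root0 (G : sgraph) : #|G| = 0 -> has_leaf_root 0 G.
Proof.
move=> G0; have no_vertex (v : G) : False by have := card0_eq G0 v.
have sym : symmetric (fun _ _ : unit => false) by [].
exists (SGraph sym (fun=> erefl)); split.
  split; first by rewrite card_unit.
    by case=> -[]; apply: connect0.
  by case=> //= x [|y c] //; case: x => //; case: y.
exists (fun v => False_rect _ (no_vertex v)); split=> [v|/=|v]; try by case: (no_vertex v).
apply/setP => x; rewrite inE; apply/cards1P/imsetP => [[y]|[v]].
  by move/setP/(_ y); rewrite !inE eqxx.
by case: (no_vertex v).
Qed.

(** A tree with a leaf has a second one, so a graph of order 1 has infinite leaf rank. *)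
Lemma no_leaf_root1 (G : sgraph) (k : nat) : #|G| = 1 -> ~ has_leaf_root k G.
Proof.
move=> G1 [T [treeT [f [_ leavesT _]]]].
have /card1P[v Gv] : #|G| == 1 by rewrite G1.
have fv : f v \in leaves T by rewrite leavesT imset_f.
have [y] := tree_other_leaf treeT fv.
rewrite leavesT => /imsetP[w _ ->].
by have := Gv w; rewrite !inE => /esym/eqP->; rewrite eqxx.
Qed.

Theorem theorem13 (G : sgraph) (n : nat) (order_G : #|G| = n) :
  infinite_leaf_rank G \/
  exists k : nat, is_leaf_rank G k /\ k <= 2 * n * 2 ^ (2 * n).
Proof.
have [[k0 rootG]|] := classic (exists k, has_leaf_root k G); last by left.
right.
have [k [root_k k_le]] : exists k, has_leaf_root k G /\ k <= 2 * n * 2 ^ (2 * n).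
  case: (ltngtP n 1) => n1.
  - by exists 0; split=> //; apply: leaf_root0; lia.
  - exists (6 * 2 ^ (2 * n).-1 + 2); split.
      by rewrite -order_G; apply: leaf_root_rescaling rootG; rewrite order_G.
    (* With [X = 2 ^ (2 * n).-1] and [n >= 2], [6 * X + 2 <= 8 * X <= 4 * n * X]. *)
    have X8 : 2 ^ 3 <= 2 ^ (2 * n).-1 by rewrite leq_exp2l //; lia.
    have -> : 2 ^ (2 * n) = 2 * 2 ^ (2 * n).-1 by rewrite -expnS prednK //; lia.
    rewrite -[2 ^ 3]/8 in X8; nia.
  by case: (no_leaf_root1 _ rootG); rewrite order_G.
(* Classical descent to the least [k]; the bound survives every decrease. *)
have [m] := ubnP k; elim: m k root_k k_le => // m IH k root_k k_le lt_k.
have [minimal|] := classic (forall j, has_leaf_root j G -> k <= j).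
  by exists k.
move=> not_min; apply: NNPP => no_rank; apply: not_min => j root_j.
rewrite leqNgt; apply/negP => jk; apply: no_rank.
by apply: (IH j root_j); lia.
Qed.
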